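(* The canonical summable ideal $\mathrm{Sum}_{1/n}$ and the Hindman ideal $\mathcal{H}$ are incomparable in the Gamified Katětov order. That is, $$\mathrm{Sum}_{1/n}\not\leq_{\mathrm{LT}}^{\mathsf{o}}\mathcal{H}\qquad\text{and}\qquad\mathcal{H}\not\leq_{\mathrm{LT}}^{\mathsf{o}}\mathrm{Sum}_{1/n}.$$
   Context: **The ideals.** $\mathrm{Sum}_{1/n}:=\{A\subseteq\omega : \sum_{n\in A}\frac{1}{n+1}<\infty\}$. For $B\subseteq\omega$, $\mathrm{FS}(B):=\{\sum_{n\in F}n : F\subseteq B\text{ finite and nonempty}\}$ is the set of all finite nonempty sums of distinct elements of $B$. The Hindman ideal is $\mathcal{H}:=\{A\subseteq\omega : \text{for every infinite } B\subseteq\omega,\ \mathrm{FS}(B)\not\subseteq A\}$. **Upper sets and duals.** An upper set $\mathcal{U}\subseteq\mathcal{P}(\omega)$ is a family closed upward under $\subseteq$; a lower set is a family closed downward under $\subseteq$. An ideal is a lower set closed under finite unions. The dual upper set of a lower set $\mathcal{I}$ is $\mathcal{I}^*:=\{A\subseteq\omega : \omega\setminus A\in\mathcal{I}\}$. **Trees.** ${}^{<\omega}\omega$ is the set of finite strings of natural numbers, ${}^{\omega}\omega$ the set of infinite strings; $p\upharpoonright n$ is the prefix of $p$ of length $n$, and $\sigma^\frown n$ is $\sigma$ extended by the entry $n$. A tree is a set $T\subseteq{}^{<\omega}\omega$ containing the empty string and closed under initial segments; $[T]:=\{p\in{}^{\omega}\omega : p\upharpoonright n\in T\ \text{for all } n\}$.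 For an upper set $\mathcal{V}$, a tree $T$ is $\mathcal{V}$-branching if for every $\sigma\in T$ (including the root) $\{n\in\omega : \sigma^\frown n\in T\}\in\mathcal{V}$. **Partial continuous functions.** A partial continuous function $\Phi:\subseteq{}^{\omega}\omega\to\omega$ is one determined by a partial function $\varphi:\subseteq{}^{<\omega}\omega\to\omega$ that is coherent (if $\sigma,\tau\in\mathrm{dom}(\varphi)$ and $\sigma$ is a prefix of $\tau$ then $\varphi(\sigma)=\varphi(\tau)$), via: $p\in\mathrm{dom}(\Phi)$ and $\Phi(p)=c$ iff there is $n$ with $p\upharpoonright n\in\mathrm{dom}(\varphi)$ and $\varphi(p\upharpoonright n)=c$. **Gamified Katětov order.** For upper sets $\mathcal{U},\mathcal{V}\subseteq\mathcal{P}(\omega)$, write $\mathcal{U}\leq_{\mathrm{LT}}^{\mathsf{o}}\mathcal{V}$ iff there exists a partial continuous function $\Phi:\subseteq{}^{\omega}\omega\to\omega$ such that for every $A\in\mathcal{U}$ there is a $\mathcal{V}$-branching tree $T$ with $[T]\subseteq\mathrm{dom}(\Phi)$ and $\Phi(p)\in A$ for all $p\in[T]$. For lower sets (in particular ideals) $\mathcal{I},\mathcal{J}$, write $\mathcal{I}\leq_{\mathrm{LT}}^{\mathsf{o}}\mathcal{J}$ iff $\mathcal{I}^*\leq_{\mathrm{LT}}^{\mathsf{o}}\mathcal{J}^*$. *)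

(* Defs.v *)
From mathcomp Require Import all_boot all_order all_algebra finmap.
From mathcomp Require Import boolp classical_sets functions cardinality reals.
From mathcomp Require Import ereal esum.

Set Implicit Arguments.
Unset Strict Implicit.
Unset Printing Implicit Defensive.
Import Order.TTheory GRing.Theory Num.Theory.
Local Open Scope classical_set_scope.
Local Open Scope ring_scope.

Definition upper_set (U : set (set nat)) : Prop :=
  forall A B, A `<=` B -> U A -> U B.

Definition lower_set (I : set (set nat)) : Prop :=
  forall A B, A `<=` B -> I B -> I A.

Definition dual (I : set (set nat)) : set (set nat) := [set A | I (~` A)].

Definition summable_ideal (R : realType) : set (set nat) :=
  [set A | (\esum_(n in A) ((n.+1%:R : R)^-1)%:E < +oo)%E].

Definition FS (B : set nat) : set nat :=
  [set (\sum_(n <- F) n)%N |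
    F in [set F : {fset nat} | F != fset0 /\ [set` F] `<=` B]].

Definition hindman_ideal : set (set nat) :=
  [set A | forall B : set nat, infinite_set B -> ~ FS B `<=` A].

Definition is_tree (T : set (seq nat)) : Prop :=
  T [::] /\ forall s t, prefix s t -> T t -> T s.

(* [mkseq p n] is the prefix of length n of the infinite string p. *)
Definition body (T : set (seq nat)) : set (nat -> nat) :=
  [set p | forall n, T (mkseq p n)].

Definition branching (V : set (set nat)) (T : set (seq nat)) : Prop :=
  forall s, T s -> V [set n | T (rcons s n)].

(* Partial functions are option-valued, [None] meaning undefined. *)
Definition coherent (phi : seq nat -> option nat) : Prop :=
  forall s t, phi s <> None -> phi t <> None -> prefix s t -> phi s = phi t.

Definition partial_continuous (Phi : (nat -> nat) -> option nat) : Prop :=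
  exists2 phi : seq nat -> option nat, coherent phi &
    forall p c, Phi p = Some c <-> exists n, phi (mkseq p n) = Some c.

(* Meant for upper sets U and V. *)
Definition upper_le_LT (U V : set (set nat)) : Prop :=
  exists2 Phi : (nat -> nat) -> option nat, partial_continuous Phi &
    forall A, U A ->
      exists T : set (seq nat), [/\ is_tree T, branching V T &
        forall p, body T p -> exists2 c, Phi p = Some c & A c].

(* Meant for lower sets I and J. *)
Definition le_LT (I J : set (set nat)) : Prop :=
  upper_le_LT (dual I) (dual J).

Lemma dual_upper_set (I : set (set nat)) : lower_set I -> upper_set (dual I).
Proof. by move=> lI A B AB; apply: lI; apply: subsetC. Qed.

Lemma summable_ideal_lower_set (R : realType) : lower_set (summable_ideal R).
Proof.
move=> A B AB; apply: le_lt_trans.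
rewrite (esum_mkcond A) (esum_mkcond B); apply: le_esum => n _.
have pos : (0 <= ((n.+1%:R : R)^-1)%:E)%E by rewrite lee_fin invr_ge0 ler0n.
case: ifPn => [/set_mem/AB/mem_set -> //|_].
by case: ifP.
Qed.

Lemma hindman_ideal_lower_set : lower_set hindman_ideal.
Proof. by move=> A B AB hB C iC CA; apply: (hB C iC); apply: subset_trans AB. Qed.

(* Main.v *)
Require Import Defs.
From mathcomp Require Import all_boot reals.
From mathcomp Require Import all_order all_algebra finmap zify ring.
From mathcomp Require Import boolp classical_sets functions cardinality fsbigop.
From mathcomp Require Import filter ereal sequences esum.

(** Both halves follow from one criterion, [not_le_LT_of_hits], which removes
    the trees. Fix a partial continuous function Phi. If a J*-branching tree
    sends all its branches into A, then its root is barred: it lies in the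
    inductive closure of the nodes at which Phi is already decided with a value
    in A, under passing to a node with J*-many such successors. An adversary
    who answers with J-positive sets of successors, and who forces the value
    into E, meets every such tree ([barred_meet]). So I is not below J once
    there is some E in I that the adversary can force.

    Say that a node is constant if the adversary can force a single value
    there. Suppose that a node s is not constant, but that the set P_s of its
    constant successors is J-positive, with values given by f_s. Then all
    fibres of f_s on P_s are in J. If the preimage of E under f_s is still
    positive in P_s, the adversary can force E at s. There are only countably
    many nodes, and the remaining ones are handled by induction. Hence it
    suffices to find, for every countable family of functions f_s on positive
    sets P_s with fibres in J, a single E in I such that the preimage of E under
    f_s is J-positive in P_s for every s.

    When J is the summable ideal and I is the Hindman ideal, E is a union of
    finite stages. A stage lies far above the bound M of the earlier ones and
    inside one residue class modulo M + 1. If b comes from an earlier stage and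
    b' from a later one, then b + b' is too small for the stages after that of
    b', too large for the stages before, and in the wrong residue class for the
    stage of b' itself ([stages_hindman]). Each stage can be given as much
    harmonic weight as desired on one of the P_s ([stage_step]).

    When J is the Hindman ideal and I is the summable ideal, it is enough to
    find for each f on a positive set P a set E of small weight, and to take
    the union of these sets ([small_hit]). Let p be an idempotent ultrafilter
    containing the finite sums of some infinite set inside P; it exists by the
    Ellis argument, done here with filters ([idempotent_ultrafilter]). For each
    x, the values f(x + y) either have a p-limit in the natural numbers or tend
    to infinity along p. Galvin's construction of an infinite sequence b whose
    finite sums lie in P ([FS_fusion]) can then be run so that the partial sums
    produce, at stage k, at most 2 ^ k.+1 new values or limits, all beyond a
    bound chosen in advance. Their total weight is therefore small. *)

Set Implicit Arguments.
Unset Strict Implicit.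
Unset Printing Implicit Defensive.
Import Order.TTheory GRing.Theory Num.Theory.
Local Open Scope classical_set_scope.

(** * Games on trees and the reduction order *)

Lemma dependent_choice_seq (P : seq nat -> Prop) (R : seq nat -> nat -> Prop) :
  P [::] -> (forall s, P s -> exists2 n, P (rcons s n) & R s n) ->
  exists b : nat -> nat, forall k, P (mkseq b k) /\ R (mkseq b k) (b k).
Proof.
move=> P0 step.
have /choice[g gP] s : exists n, P s -> P (rcons s n) /\ R s n.
  have [/step[n Pn Rn]|nPs] := pselect (P s); first by exists n.
  by exists 0.
pose u k := iter k (fun s => rcons s (g s)) [::].
have uE k : mkseq (fun i => g (u i)) k = u k.
  by elim: k => // k IHk; rewrite mkseqS IHk.
have Pu k : P (u k) by elim: k => // k IHk; apply: (gP _ IHk).1.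
by exists (fun k => g (u k)) => k; rewrite uE; split; last exact: (gP _ (Pu k)).2.
Qed.

(** [D s c] is read as: the value of Phi is already known to be c once the
    finite string s has been read. The set V is [dual J] for the player who
    follows a tree, and [~` J] for the adversary. The set W in [barred_node]
    replaces the set of all barred successors, which would not occur strictly
    positively; for an upper set V the two versions agree. *)
Section Barred.
Variables (V : set (set nat)) (D : seq nat -> nat -> Prop).

Inductive barred (A : set nat) : seq nat -> Prop :=
| barred_leaf s c : D s c -> A c -> barred A s
| barred_node s W :
    V W -> (forall n, W n -> barred A (rcons s n)) -> barred A s.

End Barred.

(** A root that is not barred starts a branch of T on which no prefix is barred,
    whereas the value of Phi on that branch is decided at a finite stage. *)
Lemma barred_tree (V : set (set nat)) (D : seq nat -> nat -> Prop)
    (A : set nat) (T : set (seq nat)) :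
  is_tree T -> branching V T ->
  (forall p, body T p -> exists n c, D (mkseq p n) c /\ A c) ->
  barred V D A [::].
Proof.
move=> [T0 _] brT bodyT; apply: contrapT => nbar.
pose P s := T s /\ ~ barred V D A s.
have [|s [Ts nb]|p pP] := @dependent_choice_seq P (fun _ _ => True).
- by split.
- apply: contrapT => nex; apply: nb; apply: (barred_node (brT s Ts)) => n Tn.
  by apply: contrapT => nb; apply: nex; exists n.
have [n|n [c [Dc Ac]]] := bodyT p; first by have [[]] := pP n.
by have [[_ nb] _] := pP n; apply: nb; apply: barred_leaf Dc Ac.
Qed.

(** Properness matters: if J contained every set, the empty set would be in
    [dual J], and the tree with the root alone would be branching and would have
    no branch at all. *)
Definition set_ideal (J : set (set nat)) : Prop :=
  [/\ lower_set J, J set0, forall A B, J A -> J B -> J (A `|` B) & ~ J setT].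

Section BarredMeet.
Variables (J : set (set nat)) (D : seq nat -> nat -> Prop).
Hypothesis Jideal : set_ideal J.
Hypothesis Dmono : forall s n c, D s c -> D (rcons s n) c.
Hypothesis Dfun : forall s c c', D s c -> D s c' -> c = c'.

Lemma barred_decided (V : set (set nat)) (A : set nat) s c :
  (forall W, V W -> W !=set0) -> barred V D A s -> D s c -> A c.
Proof.
move=> Vn0; elim=> {s} [s c' Dc' Ac' Dc|s W VW _ IH Dc].
  by rewrite (Dfun Dc Dc').
by have [n Wn] := Vn0 _ VW; apply: (IH n Wn); apply: Dmono.
Qed.

(** A set in [dual J] meets every J-positive set, so the two strategies can be
    played against each other down to a node where the value is decided. *)
Lemma barred_meet (A E : set nat) s :
  barred (dual J) D A s -> barred (~` J) D E s -> A `&` E !=set0.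
Proof.
have [Jlow J0 _ JT] := Jideal.
have meet W X : dual J W -> ~ J X -> W `&` X !=set0.
  move=> JW JX; apply: contrapT => nWX; apply: JX.
  by apply: Jlow JW => n Xn Wn; apply: nWX; exists n.
have dualn0 W : dual J W -> W !=set0.
  by move=> JW; have [n [Wn _]] := meet W setT JW JT; exists n.
have posn0 X : (~` J) X -> X !=set0.
  by move=> JX; apply/set0P/negP => /eqP X0; apply: JX; rewrite X0.
elim=> {s} [s c Dc Ac barE|s W JW barW IH barE].
  by exists c; split => //; apply: barred_decided posn0 barE Dc.
case: barE JW barW IH => {s} [s c Dc Ec|s X JX barX] JW barW IH.
  exists c; split => //; apply: barred_decided dualn0 _ Dc.
  exact: barred_node JW barW.
by have [n [Wn Xn]] := meet _ _ JW JX; apply: (IH n Wn); apply: barX.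
Qed.

End BarredMeet.

(** The adversary's hypothesis at one node: if f takes no value on a J-positive
    part of P, then E still captures a positive part of P. *)
Definition hits (J : set (set nat)) (E P : set nat) (f : nat -> nat) : Prop :=
  ~ J P -> (forall c, J (P `&` f @^-1` [set c])) -> ~ J (P `&` f @^-1` E).

(** The set E is chosen against all nodes at once, before it is known which of
    them matter. The tree for the complement of E is then used to show that the
    root is constant, as otherwise the adversary forces E. The tree for the
    complement of the single constant value finishes the argument. *)
Theorem not_le_LT_of_hits (I J : set (set nat)) :
  set_ideal J -> (forall c, I [set c]) ->
  (forall (P : seq nat -> set nat) (f : seq nat -> nat -> nat),
     exists2 E, I E & forall s, hits J E (P s) (f s)) ->
  ~ le_LT I J.
Proof.
move=> Jideal I1 Ihits [Phi [phi phi_coh PhiE] IJ].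
have [Jlow _ JU JT] := Jideal.
(* Closing phi under extension makes it monotone, and coherence keeps it
   single-valued. *)
pose D s c := exists2 t, prefix t s & phi t = Some c.
have Dmono s n c : D s c -> D (rcons s n) c.
  by case=> t ts pt; exists t => //; apply: prefix_trans ts (prefix_rcons _ _).
have Dfun s c c' : D s c -> D s c' -> c = c'.
  move=> [t ts pt] [t' t's pt']; apply: Some_inj; rewrite -pt -pt'.
  wlog le_tt' : t t' c c' ts pt t's pt' / size t <= size t'.
    move=> wl; have [lett'|/ltnW let't] := leqP (size t) (size t').
      exact: wl ts pt t's pt' lett'.
    by symmetry; apply: wl t's pt' ts pt let't.
  apply: phi_coh; rewrite ?pt ?pt'// prefixE.
  move: ts t's; rewrite !prefixE => /eqP ts /eqP t's.
  by rewrite -t's take_takel // ts.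
have win A : dual I A -> barred (dual J) D A [::].
  move=> /IJ[T [trT brT bodyT]]; apply: barred_tree trT brT _ => p /bodyT[c].
  move=> /PhiE[n pn] Ac; exists n, c; split => //.
  by exists (mkseq p n) => //; apply: prefix_refl.
have lose E : I E -> ~ barred (~` J) D E [::].
  move=> IE barE; have /win barC : dual I (~` E) by rewrite /dual/= setCK.
  by have [c []] := barred_meet Jideal Dmono Dfun barC barE.
(* [P s] collects the successors where the adversary can force one value, and
   [f s] picks such a value. *)
pose const c s := barred (~` J) D [set c] s.
pose P s := [set n | exists c, const c (rcons s n)].
have /choice[f fP] (s : seq nat) : exists g : nat -> nat,
    forall n, P s n -> const (g n) (rcons s n).
  have /choice[g gP] n : exists c, P s n -> const c (rcons s n).
    by have [[c]|nP] := pselect (P s n); [exists c|exists 0].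
  by exists g.
have [E IE Ehits] := Ihits P f.
have barE_upto s : barred (dual J) D (~` E) s ->
    (exists c, const c s) \/ barred (~` J) D E s.
  elim=> {s} [s c Dc _|s W JW _ IH].
    by left; exists c; apply: barred_leaf Dc _.
  have [JQ|JQ] := pselect (J [set n | barred (~` J) D E (rcons s n)]); last first.
    by right; apply: barred_node JQ _.
  have JP : ~ J (P s).
    move=> JP; apply: JT; apply: Jlow (JU _ _ JW (JU _ _ JQ JP)) => n _.
    have [Wn|nWn] := pselect (W n); last by left.
    by right; case: (IH n Wn) => ?; [right|left].
  have [[c Jc]|Jc] := pselect (exists c, ~ J (P s `&` f s @^-1` [set c])).
    left; exists c; apply: (barred_node Jc) => n [Pn /= <-].
    exact: fP.
  (* Successors with a value in E: forcing {f s n} there forces E. *)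
  right; apply: barred_node (Ehits s JP _) _ => [c|n [Pn En]].
    by apply: contrapT => nJ; apply: Jc; exists c.
  elim: (fP s n Pn) => [t c Dc cE|t X JX _ IHX].
    by apply: barred_leaf Dc _; rewrite cE.
  exact: barred_node JX IHX.
have /win/barE_upto[[c /(lose _ (I1 c))//]|/lose] : dual I (~` E).
  by rewrite /dual/= setCK.
exact.
Qed.

(** * Ideals and harmonic weight *)

Section Ideals.
Variable J : set (set nat).
Hypothesis Jideal : set_ideal J.

Lemma ideal_bigcup_lt (A : nat -> set nat) m :
  (forall i, i < m -> J (A i)) -> J (\bigcup_(i < m) A i).
Proof.
have [_ J0 JU _] := Jideal.
elim: m => [|m IHm] JA; first by rewrite bigcup_mkord big_ord0.
rewrite bigcup_mkord big_ord_recr/= -bigcup_mkord.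
by apply: JU; [apply: IHm => i /ltnW; apply: JA|apply: JA].
Qed.

Lemma positive_tail (P : set nat) (f : nat -> nat) N :
  ~ J P -> (forall c, J (P `&` f @^-1` [set c])) ->
  ~ J (P `&` [set n | N < f n]).
Proof.
have [Jlow _ JU _] := Jideal.
move=> JP Jf JN; apply: JP.
apply: Jlow (JU _ _ JN (@ideal_bigcup_lt _ N.+1 (fun c _ => Jf c))) => n Pn.
by have [fn|fn] := ltnP N (f n); [left|right; exists (f n)].
Qed.

End Ideals.

Section Weight.
Local Open Scope ring_scope.
Local Open Scope ereal_scope.
Variable R : realType.

Definition weight (A : set nat) : \bar R :=
  \esum_(n in A) ((n.+1%:R : R)^-1)%:E.

Let pos n : 0 <= ((n.+1%:R : R)^-1)%:E.
Proof. by rewrite lee_fin invr_ge0 ler0n. Qed.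

Lemma weight_ge0 A : 0 <= weight A.
Proof. exact: esum_ge0. Qed.

Lemma weight_le A B : A `<=` B -> weight A <= weight B.
Proof.
move=> AB; rewrite /weight (esum_mkcond A) (esum_mkcond B).
apply: le_esum => n _; case: ifPn => [/set_mem/AB/mem_set -> //|_].
by case: ifP.
Qed.

(** Subadditivity follows from additivity on disjoint unions after replacing
    [A k] by its part outside the previous sets. *)
Lemma weight_bigcup (A : nat -> set nat) :
  weight (\bigcup_k A k) <= \sum_(k <oo) weight (A k).
Proof.
rewrite seqDU_bigcup_eq /weight nneseries_sum_bigcup//.
apply: lee_nneseries => [i _ _|i _]; first exact: esum_ge0.
by apply: weight_le; apply: subset_seqDU.
Qed.

(** The form in which countably many small sets are collected. *)
Lemma weight_bigcup_geometric (A : nat -> set nat) (e : R) : (0 <= e)%R ->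
  (forall k, weight (A k) <= (e / (2 ^ k.+1)%:R)%:E) ->
  weight (\bigcup_k A k) <= e%:E.
Proof.
move=> e0 Ae; apply: le_trans (weight_bigcup A) _.
apply: le_trans (epsilon_trick0 xpredT e0).
by apply: lee_nneseries => // i _ _; apply: weight_ge0.
Qed.

Lemma weight0 : weight set0 = 0.
Proof. exact: esum_set0. Qed.

Lemma weight1 c : weight [set c] = ((c.+1%:R : R)^-1)%:E.
Proof. exact: esum_set1. Qed.

Lemma weightU A B : weight (A `|` B) <= weight A + weight B.
Proof.
have -> : A `|` B = \bigcup_k (nth set0 [:: A; B] k).
  apply/seteqP; split => [n [An|Bn]|n [[|[|k]] _ //=]].
  - by exists 0%N.
  - by exists 1%N.
  - by left.
  - by right.
  - by rewrite nth_nil.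
apply: le_trans (weight_bigcup _) _.
rewrite (nneseries_split 0 2) => [|k _]; last exact: weight_ge0.
rewrite add0n [X in _ + X]eseries0 ?adde0 => [|k k2 _].
  by rewrite big_nat_recl// big_nat1.
by rewrite nth_default// weight0.
Qed.

Lemma weight_large_fset A (w : nat) : weight A = +oo ->
  exists2 F : {fset nat}, [set` F] `<=` A & w%:R%:E <= weight [set` F].
Proof.
move=> Aoo; have : w%:R%:E < weight A by rewrite Aoo ltry.
move=> /ereal_sup_gt[_ [X [finX XA] <-]] /ltW wX.
exists (fset_set X); rewrite fset_setK//.
by rewrite /weight esum_fset.
Qed.

Lemma weight_setT : weight setT = +oo.
Proof.
have := weight_ge0 setT; case wE : (weight setT) => [y| |] // _.
case: (@dvg_harmonic R); apply: nondecreasing_is_cvgn.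
  by apply: nondecreasing_series => n _ _; apply: harmonic_ge0.
exists y => _ [n _ <-]; rewrite -lee_fin -wE /weight -nneseries_esumT//.
rewrite /series/= -sumEFin.
by apply: (nneseries_lim_ge (u_ := fun n => ((n.+1%:R : R)^-1)%:E)).
Qed.

Lemma summable_set_ideal : set_ideal (summable_ideal R).
Proof.
split; first exact: summable_ideal_lower_set.
- by rewrite /summable_ideal/= -/(weight set0) weight0 ltry.
- move=> A B; rewrite /summable_ideal/= => sA sB.
  by apply: le_lt_trans (weightU A B) _; apply: lte_add_pinfty.
- by rewrite /summable_ideal/= -/(weight setT) weight_setT ltxx.
Qed.

End Weight.

(** * Sets of finite sums *)

Lemma infinite_nat_gt (B : set nat) m : infinite_set B -> exists2 b, B b & m <= b.
Proof.
move=> Binf; apply: contrapT => nb; apply: Binf.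
apply: (sub_finite_set _ (finite_II m)) => b Bb /=.
by rewrite ltnNge; apply/negP => mb; apply: nb; exists b.
Qed.

(** Duplicate-free sequences are easier to concatenate than finite sets. *)
Lemma FS_seq (B : set nat) (s : seq nat) : uniq s -> s != [::] ->
  (forall n, n \in s -> B n) -> FS B (\sum_(n <- s) n).
Proof.
move=> us s0 sB; exists [fset n in s]%fset.
  split; last by move=> n /=; rewrite !inE; apply: sB.
  by case: s s0 {us sB} => // a s _; apply/fset0Pn; exists a; rewrite !inE eqxx.
by apply: perm_big; apply: uniq_perm => // n; rewrite inE.
Qed.

Lemma FS_self (B : set nat) n : B n -> FS B n.
Proof.
move=> Bn; have : FS B (\sum_(m <- [:: n]) m).
  by apply: FS_seq => // m; rewrite inE => /eqP ->.
by rewrite big_seq1.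
Qed.

Lemma FS_mono (B B' : set nat) : B `<=` B' -> FS B `<=` FS B'.
Proof. by move=> BB' _ [F [F0 FB] <-]; exists F => //; split=> // n /FB/BB'. Qed.

(** * The Hindman ideal is not below the summable ideal *)

Section HindmanNotSummable.
Variable R : realType.

(** M bounds the earlier stages. Two elements of a stage differ by a multiple of
    M + 1, hence never by an element of an earlier stage; and they exceed every
    sum of two elements of earlier stages. *)
Definition stage (M M' r : nat) : set nat :=
  [set a | [/\ M.*2 < a, a <= M' & a = r %[mod M.+1]]].

(** Removing finitely many fibres, and then passing to one of finitely many
    residue classes, keeps some set non-summable; a finite piece of it has
    weight at least w and determines the upper bound of the stage. The
    hypotheses on P and f are inside the existential so that the step can be
    iterated by choice without knowing whether they hold. *)
Lemma stage_step (P : set nat) (f : nat -> nat) (w M : nat) :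
  exists M'r : nat * nat, M <= M'r.1 /\
    (~ summable_ideal R P ->
     (forall c, summable_ideal R (P `&` f @^-1` [set c])) ->
     (w%:R%:E <= weight R (P `&` f @^-1` stage M M'r.1 M'r.2))%E).
Proof.
have Jideal := summable_set_ideal R; have [Jlow _ _ _] := Jideal.
have [[JP Jf]|nPf] := pselect (~ summable_ideal R P /\
     (forall c, summable_ideal R (P `&` f @^-1` [set c]))); last first.
  by exists (M, 0); split => // JP Jf; case: nPf.
have JQ := positive_tail Jideal (N := M.*2) JP Jf.
set Q := P `&` _ in JQ.
have [r Qr] : exists r, ~ summable_ideal R (Q `&` [set n | f n %% M.+1 = r]).
  apply: contrapT => nr; apply: JQ.
  apply: Jlow (ideal_bigcup_lt Jideal (m := M.+1)
    (A := fun r => Q `&` [set n | f n %% M.+1 = r]) _) => [n Qn|r _].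
    by exists (f n %% M.+1); [rewrite /= ltn_mod|].
  by apply: contrapT => Jr; apply: nr; exists r.
have Qoo : weight R (Q `&` [set n | f n %% M.+1 = r]) = +oo%E.
  by apply/eqP; rewrite -leye_eq leNgt; apply/negP.
have [F FQ wF] := weight_large_fset w Qoo.
exists (maxn M (\max_(n <- F) f n), r); split; first exact: leq_maxl.
move=> _ _; apply: (le_trans wF); apply: weight_le => n Fn.
have [[Pn Mn] nr] := FQ n Fn; split => //; split => //=.
- by rewrite leq_max; apply/orP; right; apply: leq_bigmax_seq.
- by rewrite -nr modn_mod.
Qed.

(** Only two elements of B are needed: b in stage j and b' in a stage k > j. *)
Lemma stages_hindman (M r : nat -> nat) :
  (forall k, M k <= M k.+1) ->
  hindman_ideal (\bigcup_k stage (M k) (M k.+1) (r k)).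
Proof.
move=> MS B Binf FSB.
have leM : {homo M : i j / i <= j} by apply: homo_leq => // n m p; apply: leq_trans.
have [b Bb _] := infinite_nat_gt 0 Binf.
have [j _ [jb bj _]] := FSB b (FS_self Bb).
have [b' Bb' jb'] := infinite_nat_gt (M j.+1).+1 Binf.
have [k _ [kb' b'k b'r]] := FSB b' (FS_self Bb').
have jk : j < k.
  by rewrite ltnNge; apply/negP => kj; have := leM _ _ (kj : k.+1 <= j.+1); lia.
have bk : b <= M k by apply: leq_trans bj (leM _ _ jk).
have bb' : b != b' by apply/eqP => bb'; lia.
have [m _ [mbb' bb'm bb'r]] : (\bigcup_k stage (M k) (M k.+1) (r k)) (b + b').
  apply: FSB; have -> : b + b' = \sum_(n <- [:: b; b']) n.
    by rewrite big_cons big_seq1.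
  apply: FS_seq => [|//|n]; first by rewrite /= inE bb'.
  by rewrite !inE => /orP[]/eqP ->.
(* b + b' exceeds M k but is at most 2 * M k.+1. *)
have mk : m = k.
  apply/eqP; rewrite eqn_leq; apply/andP; split; rewrite leqNgt; apply/negP => lt.
    by have := leM _ _ lt; lia.
  by have := leM _ _ lt; lia.
(* Both b' and b + b' are congruent to r k modulo M k + 1, and 0 < b <= M k. *)
subst m; have : b = 0 %[mod (M k).+1].
  by apply/eqP; rewrite -(eqn_modDr b') bb'r add0n b'r.
by rewrite mod0n modn_small ?ltnS//; lia.
Qed.

Theorem hindman_not_le_LT_summable : ~ le_LT hindman_ideal (summable_ideal R).
Proof.
apply: not_le_LT_of_hits; first exact: summable_set_ideal.
  move=> c B Binf FSB; apply: Binf; apply: sub_finite_set (finite_set1 c).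
  by move=> b /FS_self/FSB.
move=> P f.
(* Stage k serves one pair (s, w): it gives weight w to the s-th function. As w
   is unbounded for each s, the captured part of P s has infinite weight. *)
pose task (k : nat) : seq nat * nat :=
  odflt ([::], 0) (@choice.unpickle (seq nat * nat)%type k).
have /choice[next nextP] (kM : nat * nat) :=
  stage_step (P (task kM.1).1) (f (task kM.1).1) (task kM.1).2 kM.2.
pose M := nat_rect (fun=> nat) 0 (fun k Mk => (next (k, Mk)).1).
pose r k := (next (k, M k)).2.
exists (\bigcup_k stage (M k) (M k.+1) (r k)).
  by apply: stages_hindman => k; have [] := nextP (k, M k).
move=> s JP Jf; rewrite /summable_ideal/= -/(weight R _).
have large w : (w%:R%:E <= weight R (P s `&` f s @^-1`
    (\bigcup_k stage (M k) (M k.+1) (r k))))%E.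
  pose k := choice.pickle (s, w).
  have [_] := nextP (k, M k); rewrite /task /= choice.pickleK /= => /(_ JP Jf) wle.
  by apply: le_trans wle _; apply: weight_le => n [Pn sn]; split=> //; exists k.
move: large; have := weight_ge0 R (P s `&` f s @^-1`
    (\bigcup_k stage (M k) (M k.+1) (r k))).
case: (weight R _) => [y| |] // y0 large _.
have := large (Num.bound y); rewrite lee_fin leNgt => /negP; apply.
exact: archi_boundP.
Qed.

End HindmanNotSummable.

(** * Idempotent ultrafilters *)

Lemma filter_setC_false (T : Type) (F : set_system T) (A : set T) :
  ProperFilter F -> F A -> F (~` A) -> False.
Proof. by move=> PF FA FnA; have [x []] := filter_ex (filterI FA FnA). Qed.

Definition shift (A : set nat) (x : nat) : set nat := [set y | A (x + y)].

Lemma shiftD A x y : shift (shift A x) y = shift A (x + y).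
Proof. by apply/seteqP; split => z; rewrite /shift/= addnA. Qed.

(** For ultrafilters this is the sum in the Stone-Cech compactification of the
    natural numbers, continuous in its left argument. *)
Definition conv (F G : set_system nat) : set_system nat :=
  [set A | F [set x | G (shift A x)]].

Lemma conv_filter F G :
  ProperFilter F -> ProperFilter G -> ProperFilter (conv F G).
Proof.
move=> PF PG; split; last split.
- by rewrite /conv/= => /(@filter_ex _ _ PF)[x /(@filter_ex _ _ PG)[]].
- by rewrite /conv/=; apply: filterE => x; apply: filterT.
- move=> A B FA FB; rewrite /conv/=.
  apply: filterS (@filterI _ F _ _ _ FA FB) => x [GA GB].
  exact: filterI GA GB.
- move=> A B AB; rewrite /conv/=; apply: filterS => x.
  by apply: filterS => y; apply: AB.
Qed.

(** A filter F stands for the closed set of the ultrafilters that contain it;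
    the condition says that this closed set is a subsemigroup. Larger filters
    are smaller closed sets. *)
Definition semigroup_filter (F : set_system nat) : Prop :=
  ProperFilter F /\ forall q r : set_system nat,
    UltraFilter q -> UltraFilter r -> F `<=` q -> F `<=` r -> F `<=` conv q r.

(** Distinct filters give distinct closed sets of ultrafilters: otherwise the
    filter generated by F and the complement of C would be proper. *)
Lemma filter_of_ultra (F : set_system nat) (C : set nat) : ProperFilter F ->
  (forall r, UltraFilter r -> F `<=` r -> r C) -> F C.
Proof.
move=> PF FC; apply: contrapT => nFC.
have PG : ProperFilter [set X | F (X `|` C)].
  split; last split.
  - by rewrite /= set0U.
  - by rewrite /= setTU; apply: filterT.
  - by move=> A B /= FA FB; rewrite setUIl; apply: filterI.
  - by move=> A B AB /=; apply: filterS; apply: setSU.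
have [r [Ur Gr]] := ultraFilterLemma PG.
have rC : r C by apply: FC => A FA; apply: Gr => /=; apply: filterS FA => x; left.
have rnC : r (~` C) by apply: Gr; rewrite /= setvU; apply: filterT.
exact: filter_setC_false rC rnC.
Qed.

(** Compactness of the closed set of F: if b contains F + q, then b is r + q for
    any ultrafilter r above G. The filter G is proper because a set Y in F that
    misses [[set x | q (shift A x)]], with A in b, would put the complement of A
    into F + q and so into b. *)
Lemma lift_filter (F q b : set_system nat) : ProperFilter F -> UltraFilter q ->
  ProperFilter b -> conv F q `<=` b ->
  let G := [set X | exists2 Y, F Y &
              exists2 A, b A & Y `&` [set x | q (shift A x)] `<=` X] in
  [/\ ProperFilter G, F `<=` G & forall A, b A -> G [set x | q (shift A x)]].
Proof.
move=> PF Uq Pb Fqb; split.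
- split; last split.
  + move=> [Y FY [A bA YA]].
    have /Fqb bnA : conv F q (~` A).
      rewrite /conv/=; apply: filterS FY => x Yx.
      have [qA|//] := in_ultra_setVsetC (shift A x) Uq.
      by case: (YA x).
    exact: filter_setC_false bA bnA.
  + by exists setT; [apply: filterT|exists setT; [apply: filterT|]].
  + move=> X X' [Y FY [A bA YA]] [Y' FY' [A' bA' YA']].
    exists (Y `&` Y'); first exact: filterI.
    exists (A `&` A'); first exact: filterI.
    move=> x [[Yx Y'x] qx]; split; [apply: YA|apply: YA']; split => //.
      by apply: filterS qx => y [].
    by apply: filterS qx => y [].
  + move=> X X' XX' [Y FY [A bA YA]]; exists Y => //; exists A => //.
    exact: subset_trans XX'.
- move=> Y FY; exists Y => //; exists setT; first exact: filterT.
  by move=> x [].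
- move=> A bA; exists setT; first exact: filterT.
  by exists A => // x [].
Qed.

(** Minimal closed subsemigroups exist: being a semigroup filter is preserved by
    unions of chains, since q and r above the union are above each member. The
    empty family is admitted in P only to serve as the union of the empty
    chain. *)
Lemma maximal_semigroup_filter (F0 : set_system nat) : semigroup_filter F0 ->
  exists F, [/\ semigroup_filter F, F0 `<=` F &
    forall G, semigroup_filter G -> F `<=` G -> G = F].
Proof.
move=> sF0.
pose P (G : set_system nat) := G = set0 \/ (semigroup_filter G /\ F0 `<=` G).
have [|F [[F_0|[sF F0F]] Fmax]] := @Zorn_bigcup _ P.
- move=> C CP Ctot.
  have [[G CG [sG F0G]]|nC] :=
      pselect (exists2 G, C G & semigroup_filter G /\ F0 `<=` G); last first.
    left; apply/seteqP; split => // A [G CG GA].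
    by have [G0|?] := CP G CG; [rewrite G0 in GA|case: nC; exists G].
  have Cel H A : C H -> H A -> semigroup_filter H.
    by move=> CH HA; have [H0|[]//] := CP H CH; rewrite H0 in HA.
  right; split; last by move=> A F0A; exists G => //; apply: F0G.
  split.
    split; last split.
    + move=> [H CH H0]; have [PH _] := Cel _ _ CH H0.
      exact: (@filter_not_empty _ H _).
    + by exists G => //; have [PG _] := sG; apply: filterT.
    + move=> A B [H CH HA] [K CK KB].
      have [HK|KH] := Ctot _ _ CH CK.
        exists K => //; have [PK _] := Cel _ _ CK KB.
        by apply: filterI KB; apply: HK.
      exists H => //; have [PH _] := Cel _ _ CH HA.
      by apply: filterI HA _; apply: KH.
    + move=> A B AB [H CH HA]; exists H => //; have [PH _] := Cel _ _ CH HA.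
      exact: filterS AB HA.
  move=> q r Uq Ur Cq Cr A [H CH HA]; have [_ sH] := Cel _ _ CH HA.
  by apply: sH => // B HB; [apply: Cq|apply: Cr]; exists H.
- exfalso; apply: (Fmax F0 _ (or_intror (conj sF0 _))) => //.
  split; first by rewrite F_0.
  have [PF0 _] := sF0; move=> F0F.
  have : F setT by apply: F0F; apply: filterT.
  by rewrite F_0.
exists F; split => // G sG FG; apply: contrapT => GF.
apply: (Fmax G _ (or_intror (conj sG (subset_trans F0F FG)))).
by split => // GF'; apply: GF; apply/seteqP.
Qed.

(** Ellis's theorem. Let F be a minimal closed subsemigroup and q in it. Then
    F + q is a closed subsemigroup of F, so it equals F and contains q; hence
    the r in F with r + q = q form a nonempty closed subsemigroup, represented by
    G below, which by minimality is all of F and contains q. *)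
Lemma idempotent_ultrafilter (F0 : set_system nat) : semigroup_filter F0 ->
  exists p, [/\ UltraFilter p, F0 `<=` p & conv p p = p].
Proof.
move=> /maximal_semigroup_filter[F [[PF sF] F0F Fmax]].
have [q [Uq Fq]] := ultraFilterLemma PF.
have FFq : F `<=` conv F q.
  move=> A FA; apply: (@filter_of_ultra F) => r Ur Fr.
  exact: (sF r q).
have Fq_sg : semigroup_filter (conv F q).
  split; first exact: conv_filter.
  move=> a b Ua Ub Fqa Fqb A FqA.
  have [PG FG Gb] := lift_filter PF Uq _ Fqb.
  have [r [Ur Gr]] := ultraFilterLemma PG.
  have bE : conv r q = b.
    by apply: max_filter => [|B bB]; [exact: conv_filter|exact/Gr/Gb].
  have Fa : F `<=` a by apply: subset_trans FFq Fqa.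
  have Fr : F `<=` r by apply: subset_trans FG Gr.
  have := sF a r Ua Ur Fa Fr _ FqA; rewrite /conv/=.
  apply: filterS => x; rewrite -bE /conv /shift/=.
  by apply: filterS => y; apply: filterS => z /=; rewrite addnA.
have Fqq : conv F q `<=` q by rewrite (Fmax _ Fq_sg FFq).
have [PG FG Gq] := lift_filter PF Uq _ Fqq.
set G := [set X | _] in PG FG Gq.
have G_sg : semigroup_filter G.
  split => // a b Ua Ub Ga Gb X [Y FY [A qA YAX]].
  have PC : ProperFilter (conv a b) by apply: conv_filter.
  apply: filterS YAX _; apply: filterI.
    by apply: sF FY => //; apply: subset_trans FG _.
  rewrite /conv/=; have := Ga _ (Gq A qA); apply: filterS => x /= qAx.
  have := Gb _ (Gq _ qAx); apply: filterS => y /=.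
  by rewrite shiftD.
exists q; split => //; first exact: subset_trans Fq.
apply: max_filter => [|A qA]; first exact: conv_filter.
by apply: Fq; rewrite -(Fmax _ G_sg FG); apply: Gq.
Qed.

(** * Ultrafilters of finite sums and Hindman's theorem *)

Definition tail (B : set nat) (m : nat) : set nat := B `&` [set n | m <= n].

(** A finite sum only uses elements below some m', and elements beyond m' can be
    added to it without repetition. *)
Lemma FS_tailD (B : set nat) m x : FS (tail B m) x ->
  exists m', forall y, FS (tail B m') y -> FS (tail B m) (x + y).
Proof.
move=> [F [F0 FB] <-]; exists (maxn m (\max_(n <- F) n).+1) => _ [G [G0 GB] <-].
rewrite -big_cat; apply: FS_seq.
- rewrite cat_uniq !fset_uniq andbT /=; apply/hasPn => n nG; apply/negP => nF.
  have [_ /=] := GB n nG; rewrite geq_max => /andP[_].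
  by rewrite ltnNge leq_bigmax_seq.
- by apply: contra_neq F0 => FG; apply/fsetP => n; move: (mem_cat n F G);
    rewrite FG !inE; case: (n \in F).
- move=> n; rewrite mem_cat => /orP[/FB//|/GB[Bn /=]].
  by rewrite geq_max => /andP[mn _]; split.
Qed.

Lemma FS_tail_semigroup_filter (B : set nat) : infinite_set B ->
  semigroup_filter [set A | exists m, FS (tail B m) `<=` A].
Proof.
move=> Binf; split.
  split; last split.
  - move=> [m]; have [b Bb mb] := infinite_nat_gt m Binf.
    by move=> /(_ b); apply; apply: FS_self.
  - by exists 0.
  - move=> A A' [m mA] [m' mA']; exists (maxn m m') => x xm; split.
      apply: mA; apply: FS_mono xm => n [Bn /=].
      by rewrite geq_max => /andP[].
    apply: mA'; apply: FS_mono xm => n [Bn /=].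
    by rewrite geq_max => /andP[].
  - by move=> A A' AA' [m mA]; exists m; apply: subset_trans AA'.
move=> q r Uq Ur Bq Br A [m mA].
have qm : q (FS (tail B m)) by apply: Bq; exists m.
rewrite /conv/=; apply: filterS qm => x /FS_tailD[m' xm'].
by apply: Br; exists m' => y /xm'; apply: mA.
Qed.

(** The tails matter twice: they make the sets of finite sums a semigroup, and
    they keep the ultrafilter from being principal, which excludes the trivial
    idempotent at 0. *)
Lemma FS_idempotent (B : set nat) : infinite_set B ->
  exists p, [/\ UltraFilter p, conv p p = p, p (FS B) &
                forall m, p [set n | m <= n]].
Proof.
move=> Binf; have [p [Up Bp pp]] :=
  idempotent_ultrafilter (FS_tail_semigroup_filter Binf).
exists p; split => //.
  by apply: Bp; exists 0; apply: FS_mono => n [].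
move=> m; apply: Bp; exists m => _ [F [F0 FB] <-].
have /fset0Pn[n nF] := F0; have [_ /= mn] := FB n nF.
by rewrite /= (big_fsetD1 n)//=; apply: leq_trans mn (leq_addr _ _).
Qed.

(** The empty sum 0 is included, so that the finite sums with last term b are
    the x + b with x among the sums of the previous terms. *)
Definition subset_sums (s : seq nat) : seq nat :=
  foldl (fun sums b => sums ++ [seq x + b | x <- sums]) [:: 0] s.

Lemma subset_sums_rcons s b :
  subset_sums (rcons s b) = subset_sums s ++ [seq x + b | x <- subset_sums s].
Proof. by rewrite /subset_sums -cats1 foldl_cat. Qed.

Lemma size_subset_sums s : size (subset_sums s) = 2 ^ size s.
Proof.
elim/last_ind: s => // s b IHs.
by rewrite subset_sums_rcons size_cat size_map IHs size_rcons expnS mul2n addnn.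
Qed.

Lemma subset_sums0 s : 0 \in subset_sums s.
Proof.
by elim/last_ind: s => // s b IHs; rewrite subset_sums_rcons mem_cat IHs.
Qed.

Lemma subset_sums_mkseq (b : nat -> nat) k j x : j < k ->
  x \in subset_sums (mkseq b j) -> x + b j \in subset_sums (mkseq b k).
Proof.
elim: k => // k IHk; rewrite ltnS leq_eqVlt mkseqS subset_sums_rcons mem_cat.
move=> /orP[/eqP -> xk|jk xj]; last by rewrite IHk.
by apply/orP; right; apply: map_f.
Qed.

Lemma FS_range (b : nat -> nat) z : FS (range b) z ->
  exists k, exists2 x, x \in subset_sums (mkseq b k) & z = x + b k.
Proof.
move=> [F [F0 Fb] <-].
have [K FK] : exists K, forall n, n \in F -> exists2 i, i < K & b i = n.
  have /choice[i iP] n : exists i, n \in F -> b i = n.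
    have [nF|] := boolP (n \in F); last by exists 0.
    by have [i _ <-] := Fb n nF; exists i.
  exists (\max_(n <- F) i n).+1 => n nF; exists (i n); last exact: iP.
  by rewrite ltnS leq_bigmax_seq.
suff [k [_ ?]] : exists k, k < K /\ exists2 x,
    x \in subset_sums (mkseq b k) & \sum_(n <- F) n = x + b k by exists k.
elim: K F F0 {Fb} FK => [F /fset0Pn[n nF] /(_ n nF)[]//|K IHK F F0 FK].
have drop G : (forall n, n \in G -> n \in F /\ n != b K) ->
    forall n, n \in G -> exists2 i, i < K & b i = n.
  move=> GF n /GF[/FK[i + <-]]; rewrite ltnS leq_eqVlt => /orP[/eqP ->|iK _].
    by rewrite eqxx.
  by exists i.
have [bF|bF] := boolP (b K \in F); last first.
  have [|k [kK xk]] := IHK F F0; last by exists k; split => //; apply: ltnW.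
  by apply: drop => n nF; split => //; apply: contraNneq bF => <-.
exists K; split => //; exists (\sum_(n <- (F `\ b K)%fset) n).
  have [->|F'0] := eqVneq (F `\ b K)%fset fset0.
    by rewrite big_seq_fset0 subset_sums0.
  have [|i [iK [x xi ->]]] := IHK _ F'0.
    by apply: drop => n; rewrite !inE => /andP[].
  exact: subset_sums_mkseq.
by rewrite (big_fsetD1 (b K))//= addnC.
Qed.

Section Fusion.
Variable p : set_system nat.
Hypotheses (Up : UltraFilter p) (pp : conv p p = p).
Hypothesis p_tail : forall m, p [set n | m <= n].

Lemma filter_seq (s : seq nat) (A : nat -> set nat) :
  (forall x, x \in s -> p (A x)) -> p [set y | forall x, x \in s -> A x y].
Proof.
elim: s => [|a s IHs] pA; first by apply: filterS filterT => y _ x.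
have pAs x : x \in s -> p (A x) by move=> xs; apply: pA; rewrite inE xs orbT.
have pAa : p (A a) by apply: pA; rewrite inE eqxx.
apply: filterS (filterI pAa (IHs pAs)) => y [Aa As] x.
by rewrite inE => /orP[/eqP ->|/As].
Qed.

Lemma conv_idem A : p A -> p [set x | p (shift A x)].
Proof. by rewrite -{1}pp. Qed.

(** Galvin's argument. Each new term b is chosen p-often, so that for all sums x
    of the previous terms both x + b lies in A and p-many y still satisfy
    A (x + b + y). The latter is what idempotence provides, and it keeps the
    construction going. The parameter Q lets further requirements be met along
    the way, provided each of them is satisfied by p-many numbers. *)
Lemma FS_fusion (A : set nat) (Q : seq nat -> nat -> Prop) :
  p A -> (forall s, p [set b | Q s b]) ->
  exists b : nat -> nat, [/\ infinite_set (range b), FS (range b) `<=` A &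
    forall k, Q (mkseq b k) (b k)].
Proof.
move=> pA pQ.
(* The points of A that remain good centres; [shiftA'] is the idempotence step. *)
pose A' := [set x | A x /\ p (shift A x)].
have shiftA' x : p (shift A x) -> p (shift A' x).
  move=> pAx; apply: filterS (filterI pAx (conv_idem pAx)) => y [Axy].
  by rewrite /= shiftD.
have [|s sums_s|b bP] := @dependent_choice_seq
    (fun s => forall x, x \in subset_sums s -> p (shift A x))
    (fun s n => [/\ size s <= n, Q s n &
       forall x, x \in subset_sums s -> A (x + n)]).
- by move=> x; rewrite inE => /eqP ->; rewrite -[p _]/(p A).
- have pS : p [set y | forall x, x \in subset_sums s -> A' (x + y)].
    by apply: filter_seq => x /sums_s/shiftA'.
  have [n [[/= sn Qn] Sn]] :=
    filter_ex (filterI (filterI (p_tail (size s)) (pQ s)) pS).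
  exists n; last by split => // x /Sn[].
  move=> x; rewrite subset_sums_rcons mem_cat => /orP[/sums_s//|].
  by move=> /mapP[y /Sn[_ ?] ->].
exists b; split.
(* Unboundedness of b comes from [size s <= n]. *)
- move=> /finite_fsetP[F bF].
  pose m := (\max_(n <- F) n).+1.
  have : range b (b m) by exists m.
  rewrite bF /= => bmF; have [_ [+ _ _]] := bP m.
  by rewrite size_mkseq ltnNge leq_bigmax_seq.
- move=> _ /FS_range[k [x xk ->]].
  by have [_ [_ _]] := bP k; apply.
- by move=> k; have [_ []] := bP k.
Qed.

End Fusion.

Lemma hindman_positive (A : set nat) : ~ hindman_ideal A ->
  exists2 B, infinite_set B & FS B `<=` A.
Proof.
move=> HA; apply: contrapT => nB; apply: HA => B Binf BA.
by apply: nB; exists B.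
Qed.

Lemma ultrafilter_not_hindman (p : set_system nat) (A : set nat) :
  UltraFilter p -> conv p p = p -> (forall m, p [set n | m <= n]) ->
  p A -> ~ hindman_ideal A.
Proof.
move=> Up pp p_tail pA HA.
have [|b [binf bA _]] := FS_fusion Up pp p_tail (Q := fun _ _ => True) pA.
  by move=> _; apply: filterE.
exact: HA binf bA.
Qed.

(** Closure under unions is Hindman's theorem. *)
Lemma hindman_set_ideal : set_ideal hindman_ideal.
Proof.
split; first exact: hindman_ideal_lower_set.
- by move=> B /infinite_setN0[b Bb] /(_ b (FS_self Bb)).
- move=> A A' HA HA' B Binf BAA'.
  have [p [Up pp pB p_tail]] := FS_idempotent Binf.
  have [pA|pnA] := in_ultra_setVsetC A Up.
    exact: ultrafilter_not_hindman pA HA.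
  apply: (ultrafilter_not_hindman Up pp p_tail _ HA').
  by apply: filterS (filterI pB pnA) => x [/BAA'[]].
- by move=> /(_ setT infinite_nat); apply.
Qed.

(** * The summable ideal is not below the Hindman ideal *)

Section SummableNotHindman.
Local Open Scope ring_scope.
Variable R : realType.

Lemma weight_bigcup_seq (s : seq nat) (A : nat -> set nat) (d : R) :
  (forall x, x \in s -> weight R (A x) <= d%:E)%E ->
  (weight R [set v | exists2 x, x \in s & A x v] <= ((size s)%:R * d)%:E)%E.
Proof.
elim: s => [|a s IHs] Ad.
  rewrite (_ : [set v | _] = set0) ?weight0 ?mul0r//.
  by apply/seteqP; split => // v [].
have : [set v | exists2 x, x \in a :: s & A x v] `<=`
    A a `|` [set v | exists2 x, x \in s & A x v].
  by move=> v [x]; rewrite inE => /orP[/eqP ->|]; [left|right; exists x].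
move=> /(weight_le R)/le_trans; apply; apply: le_trans (weightU _ _ _) _.
rewrite /= -natr1 mulrDl mul1r addrC EFinD.
have Aa : (weight R (A a) <= d%:E)%E by apply: Ad; rewrite inE eqxx.
by apply: leeD (IHs _) Aa => x xs; apply: Ad; rewrite inE xs orbT.
Qed.

(** The relation [L x c] says that c is the limit of f (x + y) as y tends to p.
    A limit of f at x persists at x + b for p-many b, by idempotence; and if there
    is no limit at x, then both f (x + b) and the limit at x + b, if any, exceed
    any given bound for p-many b. There is no limit at 0, since the fibres of f
    on P are in the Hindman ideal. So each value f (x + b k) either repeats a
    limit that appeared earlier as a new one, or is itself new and large. *)
Lemma small_hit (P : set nat) (f : nat -> nat) (m : nat) :
  ~ hindman_ideal P ->
  (forall c, hindman_ideal (P `&` f @^-1` [set c])) ->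
  exists2 E, (weight R E <= ((2 ^ m)%:R^-1)%:E)%E &
             ~ hindman_ideal (P `&` f @^-1` E).
Proof.
move=> /hindman_positive[B Binf BP] Hf.
have [p [Up pp pB p_tail]] := FS_idempotent Binf.
have pP : p P by apply: filterS pB.
pose L x c := p [set y | f (x + y)%N = c].
have L_uniq x c c' : L x c -> L x c' -> c = c'.
  by move=> Lc Lc'; have [y [/= <- <-]] := filter_ex (filterI Lc Lc').
have L0 c : ~ L 0%N c.
  move=> Lc; apply: (ultrafilter_not_hindman Up pp p_tail _ (Hf c)).
  by apply: filterI pP _; apply: filterS Lc => y /=; rewrite add0n.
have L_idem x c : L x c -> p [set b | L (x + b)%N c].
  move=> /(conv_idem pp); apply: filterS => b /=.
  by rewrite /L/shift/=; apply: filterS => y; rewrite /= addnA.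
have L_idem' x c : p [set b | L (x + b)%N c] -> L x c.
  move=> pL; rewrite /L -pp /conv/=; apply: filterS pL => b /=.
  by apply: filterS => y; rewrite /shift/= addnA.
(* At most 2 ^ k sums x occur at stage k, each with at most two new elements, so
   that their weight is at most 2 ^ k.+1 / N k = 2 ^ - (m + k.+1). *)
pose N k := (2 ^ (m + k.*2.+2))%N.
pose Q s b := forall x, x \in subset_sums s ->
  (forall c, L x c -> f (x + b)%N = c /\ L (x + b)%N c) /\
  (~ (exists c, L x c) -> forall c, (c < N (size s))%N ->
     f (x + b)%N <> c /\ ~ L (x + b)%N c).
have pQ s : p [set b | Q s b].
  apply: filter_seq => x _.
  have [[c0 Lx]|nLx] := pselect (exists c, L x c).
    apply: filterS (filterI Lx (L_idem _ _ Lx)) => b [fb Lb]; split.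
      by move=> c /(L_uniq _ _ _ Lx) <-.
    by case; exists c0.
  have : p [set b | forall c, c \in iota 0 (N (size s)) ->
      f (x + b)%N <> c /\ ~ L (x + b)%N c].
    apply: filter_seq => c _; apply: filterI.
      have [Lc|//] := in_ultra_setVsetC [set y | f (x + y)%N = c] Up.
      by case: nLx; exists c.
    have [/L_idem' Lc|//] := in_ultra_setVsetC [set b | L (x + b)%N c] Up.
    by case: nLx; exists c.
  apply: filterS => b bc; split; first by move=> c Lc; case: nLx; exists c.
  by move=> _ c cN; apply: bc; rewrite mem_iota.
have [b [binf bP bQ]] := FS_fusion Up pp p_tail pP pQ.
pose Vx k x := [set v | ~ (exists c, L x c) /\
  (v = f (x + b k)%N \/ L (x + b k)%N v)].
pose V k := [set v | exists2 x, x \in subset_sums (mkseq b k) & Vx k x v].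
have wVx k x : x \in subset_sums (mkseq b k) ->
    (weight R (Vx k x) <= (2 * (N k).+1%:R^-1)%:E)%E.
  move=> xk; have [Lx|nLx] := pselect (exists c, L x c).
    rewrite (_ : Vx k x = set0) ?weight0 ?lee_fin//.
    by apply/seteqP; split => // v [].
  have [_ /(_ nLx) big] := bQ k x xk; rewrite size_mkseq in big.
  have w1 c : (N k <= c)%N -> (weight R [set c] <= ((N k).+1%:R^-1)%:E)%E.
    by move=> Nc; rewrite weight1 lee_fin lef_pV2 ?posrE ?ler_nat.
  have wf : (weight R [set f (x + b k)%N] <= ((N k).+1%:R^-1)%:E)%E.
    by apply: w1; rewrite leqNgt; apply/negP => /big[].
  have wL : (weight R [set c | L (x + b k)%N c] <= ((N k).+1%:R^-1)%:E)%E.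
    have [[c Lc]|nLc] := pselect (exists c, L (x + b k)%N c).
      rewrite (_ : [set _ | _] = [set c]).
        by apply: w1; rewrite leqNgt; apply/negP => /big[_]; apply.
      by apply/seteqP; split => [c' /= /L_uniq/(_ Lc)|c' /= ->].
    rewrite (_ : [set _ | _] = set0) ?weight0 ?lee_fin//.
    by apply/seteqP; split => // c Lc; case: nLc; exists c.
  apply: (@le_trans _ _ (weight R ([set f (x + b k)%N] `|`
      [set c | L (x + b k)%N c]))).
    by apply: weight_le => v [_ []]; [left|right].
  apply: le_trans (weightU _ _ _) _.
  by rewrite mulr_natl mulr2n EFinD; apply: leeD.
have wV k : (weight R (V k) <= ((2 ^ m)%:R^-1 / (2 ^ k.+1)%:R)%:E)%E.
  apply: le_trans (weight_bigcup_seq (wVx k)) _.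
  rewrite size_subset_sums size_mkseq lee_fin.
  have -> : ((2 ^ m)%:R^-1 / (2 ^ k.+1)%:R = (2 ^ k.+1)%:R / (N k)%:R :> R).
    have -> : N k = (2 ^ m * (2 ^ k.+1 * 2 ^ k.+1))%N.
      by rewrite /N -!expnD; congr (2 ^ _)%N; lia.
    have nz i : (2 ^ i)%:R != 0 :> R by rewrite pnatr_eq0 -lt0n expn_gt0.
    by rewrite !natrM; field; rewrite !nz.
  rewrite expnS mulnC natrM mulrA ler_pM2l ?mulr_gt0 ?ltr0n ?expn_gt0//.
  by rewrite lef_pV2 ?posrE ?ltr0n ?expn_gt0// ler_nat.
exists (\bigcup_k V k).
  by apply: weight_bigcup_geometric wV.
move=> Hhit; apply: (Hhit _ binf) => z zb; split; first exact: bP.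
(* Every limit at a sum of the first k terms was a new value at an earlier
   stage, by descending along the sum until the limit disappears. *)
have limits k x c : x \in subset_sums (mkseq b k) -> L x c ->
    (\bigcup_k V k) c.
  elim: k x => [|k IHk] x; first by rewrite inE => /eqP -> /L0.
  rewrite mkseqS subset_sums_rcons mem_cat => /orP[/IHk//|].
  move=> /mapP[y yk ->] Lc.
  have [[c' Lc']|nL] := pselect (exists c, L y c).
    have [/(_ c' Lc')[_ /L_uniq/(_ Lc) cE] _] := bQ k y yk.
    by rewrite cE in Lc'; apply: IHk yk Lc'.
  by exists k => //; exists y => //; split => //; right.
have [k [x xk ->]] := FS_range zb.
have [[c Lc]|nL] := pselect (exists c, L x c).
  have [/(_ c Lc)[fc _] _] := bQ k x xk.
  by rewrite /= fc; apply: limits xk Lc.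
by exists k => //; exists x => //; split => //; left.
Qed.

Theorem summable_not_le_LT_hindman : ~ le_LT (summable_ideal R) hindman_ideal.
Proof.
apply: not_le_LT_of_hits; first exact: hindman_set_ideal.
  by move=> c; rewrite /summable_ideal/= -/(weight R _) weight1 ltry.
move=> P f.
have /choice[E EP] (s : seq nat) : exists E,
    (weight R E <= (1 / (2 ^ (choice.pickle s).+1)%:R)%:E)%E /\
    hits hindman_ideal E (P s) (f s).
  have [[JP Jf]|nPf] := pselect (~ hindman_ideal (P s) /\
      (forall c, hindman_ideal (P s `&` f s @^-1` [set c]))).
    have [E wE JE] := small_hit (choice.pickle s).+1 JP Jf.
    by exists E; rewrite div1r; split.
  exists set0; rewrite weight0 lee_fin; split; first exact: divr_ge0.
  by move=> JP Jf; case: nPf.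
pose Ek k := if @choice.unpickle (seq nat) k is Some s then
   (if choice.pickle s == k then E s else set0) else set0.
exists (\bigcup_k Ek k).
  rewrite /summable_ideal/= -/(weight R _).
  apply: (@le_lt_trans _ _ 1%:E); last exact: ltry.
  apply: weight_bigcup_geometric => // k; rewrite /Ek.
  case: choice.unpickle => [s|]; last by rewrite weight0 lee_fin divr_ge0.
  case: eqP => [<-|_]; first by have [] := EP s.
  by rewrite weight0 lee_fin divr_ge0.
move=> s JP Jf; have [_ /(_ JP Jf)] := EP s; apply: contra_not.
apply: hindman_ideal_lower_set => n [Pn En]; split => //.
by exists (choice.pickle s) => //; rewrite /Ek choice.pickleK eqxx.
Qed.

End SummableNotHindman.

Theorem theoremB (R : realType) :
  ~ le_LT (summable_ideal R) hindman_ideal /\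
  ~ le_LT hindman_ideal (summable_ideal R).
Proof.
by split; [apply: summable_not_le_LT_hindman|apply: hindman_not_le_LT_summable].
Qed.
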